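(* Let $G$ be a finite connected simple graph with $n$ vertices, and let $\kappa(G)$ be its number of spanning trees. The number of chip configurations reachable from an arbitrary chip configuration with $c$ chips on $G$ is asymptotically equal to $$\frac{c^{n-1}}{(n-1)!\,\kappa(G)}$$ as $c\to\infty$. That is, if for each $c\ge 1$ we choose any chip configuration $X_c$ on $G$ with a total of $c$ chips, and $R(X_c)$ denotes the number of chip configurations reachable from $X_c$, then $R(X_c)\big/\frac{c^{n-1}}{(n-1)!\,\kappa(G)}\to 1$ as $c\to\infty$.
   Context: Label the vertices of $G$ by $1,\dots,n$. A chip configuration on $G$ is an $n$-tuple of nonnegative integers $(c_1,\dots,c_n)$, with $c_i$ the number of chips on vertex $i$; its total number of chips is $c_1+\dots+c_n$. A legal chip-firing move at vertex $i$, of degree $d_i$, is allowed when vertex $i$ has at least $d_i$ chips; it subtracts $d_i$ chips from vertex $i$ and adds one chip to each vertex adjacent to $i$. A chip configuration $C'$ is reachable from a chip configuration $C$ if some finite (possibly empty) sequence of legal chip-firing moves transforms $C$ into $C'$. *)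

(* Defs.v *)
From HB Require Import structures.
From mathcomp Require Import all_boot all_order all_algebra finmap.
From mathcomp Require Import boolp classical_sets functions cardinality.
From mathcomp Require Import reals topology normedtype sequences.

Set Implicit Arguments.
Unset Strict Implicit.
Unset Printing Implicit Defensive.

Import Order.TTheory GRing.Theory Num.Theory.
Import numFieldNormedType.Exports.

Local Open Scope nat_scope.

(* A simple graph is a symmetric irreflexive relation on a finType. *)

Definition connected_graph (V : finType) (r : rel V) : Prop :=
  forall x y : V, connect r x y.

(* ucycle also holds of [:: x; y] when xy is an edge: this is not a cycle. *)
Definition acyclic_graph (V : finType) (r : rel V) : Prop :=
  forall p : seq V, ucycle r p -> size p <= 2.

Definition is_tree (V : finType) (r : rel V) : Prop :=
  connected_graph r /\ acyclic_graph r.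

Definition edges (V : finType) (e : rel V) : {set {set V}} :=
  [set [set u.1; u.2] | u in [set u : V * V | e u.1 u.2]]%SET.

Definition edge_rel (V : finType) (F : {set {set V}}) : rel V :=
  fun x y => [set x; y]%SET \in F.

Definition spanning_tree (V : finType) (e : rel V) (F : {set {set V}}) : Prop :=
  F \subset edges e /\ is_tree (edge_rel F).

Definition num_spanning_trees (V : finType) (e : rel V) : nat :=
  #|[set F : {set {set V}} | `[< spanning_tree e F >]]%SET|.

Definition config (V : finType) : Type := {ffun V -> nat}.

Definition chips (V : finType) (C : config V) : nat := \sum_(i : V) C i.

Definition degree (V : finType) (e : rel V) (i : V) : nat := #|[pred j | e i j]|.

Definition fire (V : finType) (e : rel V) (i : V) (C : config V) : config V :=
  [ffun j => if j == i then C j - degree e i else C j + e i j].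

Definition legal_move (V : finType) (e : rel V) : rel (config V) :=
  fun C D => [exists i : V, (degree e i <= C i) && (D == fire e i C)].

Definition reachable (V : finType) (e : rel V) (C D : config V) : Prop :=
  exists2 s : seq (config V), path (legal_move e) C s & last C s = D.

(* fset_set is only meaningful on finite sets; see finite_reachable. *)
Definition num_reachable (V : finType) (e : rel V) (C : config V) : nat :=
  #|` fset_set [set D | reachable e C D]%classic|%fset.

Lemma chips_fire (V : finType) (e : rel V) (i : V) (C : config V) :
  irreflexive e -> degree e i <= C i -> chips (fire e i C) = chips C.
Proof.
move=> eirr le_deg; rewrite /chips (bigD1 i) //= [RHS](bigD1 i) //= ffunE eqxx.
under eq_bigr => j /negbTE ji do rewrite ffunE ji.
rewrite big_split /= addnCA [X in _ + (_ + X) = _](_ : _ = degree e i).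
  by rewrite addnC subnK // addnC.
rewrite /degree -sum1_card [RHS]big_mkcond [RHS](bigD1 i) //= inE eirr add0n.
by apply: eq_bigr => j _; rewrite inE; case: (e i j).
Qed.

Lemma chips_reachable (V : finType) (e : rel V) (C D : config V) :
  irreflexive e -> reachable e C D -> chips D = chips C.
Proof.
move=> eirr [s + <-]; elim: s C => //= E s IH C /andP[/existsP[i]].
by move=> /andP[le_deg /eqP ->] /IH ->; exact: chips_fire.
Qed.

Lemma finite_reachable (V : finType) (e : rel V) (C : config V) :
  irreflexive e -> finite_set [set D | reachable e C D]%classic.
Proof.
move=> eirr; pose f (g : {ffun V -> 'I_(chips C).+1}) : config V :=
  [ffun i => nat_of_ord (g i)].
apply: (@sub_finite_set _ _ (range f)); last exact: finite_image.
move=> D /= /(chips_reachable eirr) DC.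
exists [ffun i => inord (D i)] => //; apply/ffunP => i; rewrite !ffunE inordK //.
by rewrite ltnS -DC /chips (bigD1 i) //= leq_addr.
Qed.

(* Main.v *)
Require Import Defs.
From HB Require Import structures.
From mathcomp Require Import all_boot all_order all_algebra finmap.
From mathcomp Require Import fingroup perm zify ring.
From mathcomp Require Import boolp classical_sets functions cardinality.
From mathcomp Require Import reals topology normedtype sequences.

(** Fix a vertex q. Firing vertex i subtracts row i of the Laplacian, so the
    configurations reachable from X have as many chips as X and differ from X
    by an integer combination of Laplacian rows. Let L be the lattice in Z^V
    spanned by the rows of the grounded Laplacian: the Laplacian whose row q is
    replaced by the unit vector at q. Two configurations with the same number
    of chips differ by Laplacian rows exactly when they are congruent modulo L,
    so the reachable configurations lie in the class of X modulo L.

    Conversely, a configuration D of that class, with as many chips as X in all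
    and with at least as many chips on each vertex as its degree, is reachable
    from X ([lattice_reachable]). Indeed D is the result of firing each vertex
    of X a nonnegative number of times, legally or not; a vertex i that must be fired most often loses
    at least as much as it receives, so X already has at least D i chips on it,
    which is at least the degree of i, and it may be fired at once. Induct on
    the total number of firings.

    It remains to count a class. The quotient of Z^V by L is finite, of order
    the determinant of the grounded Laplacian, by the Smith normal form
    ([lattice_index]). This order is the number of spanning trees: expanding
    the determinant row by row gives a sum over the maps that send each vertex
    other than q to a neighbour, in which a map contributes 1 if all its orbits
    end in q and 0 otherwise ([det_grounded_laplacian]), and these maps are the
    spanning trees oriented towards q ([num_spanning_trees_parent_maps]).

    All classes have about the same size. For some constant b, any class can be
    carried into any other by adding a suitable configuration with b chips,
    which may moreover be taken at least the degree on each vertex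
    ([exists_uniform_translation]). Hence, with k spanning trees, n = m + 1
    vertices and c chips, the number R of reachable configurations
    satisfies C(m + c - b, m) <= k R <= C(m + c + b, m) for c >= b
    ([num_reachable_bounds]), and both bounds are equivalent to c^m / m!. *)

Set Implicit Arguments.
Unset Strict Implicit.
Unset Printing Implicit Defensive.

Import Order.TTheory GRing.Theory Num.Theory.
Import numFieldNormedType.Exports.

Local Open Scope classical_set_scope.
Local Open Scope ring_scope.

(** * Spanning trees as parent maps *)

(** A spanning tree oriented towards its root [q], each vertex being sent to its
    parent. The root has none: making it a fixed point keeps [f] total. *)
Definition parent_map (V : finType) (r : rel V) (q : V) (f : {ffun V -> V}) :=
  [forall x, (if x == q then f x == q else r x (f x)) && fconnect f x q].

Section ParentMaps.
Local Open Scope nat_scope.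
Variables (V : finType) (q : V).
Implicit Types (r : rel V) (f g : {ffun V -> V}) (F : {set {set V}}).

Lemma parent_mapP r f :
  reflect [/\ f q = q, forall x, x != q -> r x (f x) & forall x, fconnect f x q]
          (parent_map r q f).
Proof.
apply: (iffP forallP) => [fP | [fq fr fc] x].
  split=> [|x xq|x].
  - by have := fP q; rewrite eqxx => /andP[/eqP].
  - by have := fP x; rewrite (negbTE xq) => /andP[].
  - by have /andP[] := fP x.
by rewrite fc andbT; case: eqVneq => [->|/fr //]; rewrite fq.
Qed.

Lemma depth_parent f x :
  fconnect f x q -> x != q -> findex f x q = (findex f (f x) q).+1.
Proof. by move=> fxq xq; apply: fconnect_findex; rewrite 1?eq_sym. Qed.

(** Induction from the root, on the number of steps from a vertex to [q]. *)
Lemma parent_map_ind f (P : V -> Prop) :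
    (forall x, fconnect f x q) -> P q -> (forall x, x != q -> P (f x) -> P x) ->
  forall x, P x.
Proof.
move=> fc Pq Pf x; have [n] := ubnP (findex f x q).
elim: n x => // n IHn x lt_n; have [-> //|xq] := eqVneq x q.
by apply: Pf => //; apply: IHn; move: lt_n; rewrite (depth_parent (fc x)).
Qed.

(** Breadth-first search: send each vertex to a neighbour closer to [q]. *)
Lemma exists_parent_map r : connected_graph r -> exists f, parent_map r q f.
Proof.
move=> r_conn.
pose reach x n := [exists p : n.-tuple V, path r x p && (last x p == q)].
have reachP x : exists n, reach x n.
  have /connectP[p rp qE] := r_conn x q; exists (size p).
  by apply/existsP; exists (in_tuple p); rewrite /= rp -qE eqxx.
pose d x := ex_minn (reachP x).
have step x : x != q -> exists y, r x y && (d y < d x).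
  move=> xq; rewrite {2}/d; case: ex_minnP => n /existsP[[p szp] /=].
  case: p szp => [|y p] /=; first by rewrite (negbTE xq).
  move=> /eqP szp /andP[/andP[rxy yp] pq] _; exists y; rewrite rxy -szp ltnS /=.
  rewrite /d; case: ex_minnP => k _; apply; apply/existsP.
  by exists (in_tuple p); rewrite /= yp.
pose f := [ffun x =>
  if x == q then q else odflt q [pick y | r x y && (d y < d x)]].
have fq : f q = q by rewrite ffunE eqxx.
have fP x : x != q -> r x (f x) && (d (f x) < d x).
  move=> xq; rewrite ffunE (negbTE xq); case: pickP => //= no_y.
  by have [y] := step x xq; rewrite no_y.
exists f; apply/parent_mapP; split=> // [x /fP/andP[] // | x].
have [n] := ubnP (d x); elim: n x => // n IHn x lt_n.
have [-> //|/fP /andP[_ lt_d]] := eqVneq x q.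
by apply: connect_trans (fconnect1 f x) (IHn _ (leq_trans lt_d _)).
Qed.

Definition parent_edges f : {set {set V}} :=
  [set [set x; f x] | x in predC1 q]%SET.

Lemma set2_eq (x y z w : V) :
  ([set x; y] = [set z; w])%SET -> (x = z /\ y = w) \/ (x = w /\ y = z).
Proof.
move=> E; have: x \in [set z; w]%SET by rewrite -E set21.
have: y \in [set z; w]%SET by rewrite -E set22.
have: z \in [set x; y]%SET by rewrite E set21.
have: w \in [set x; y]%SET by rewrite E set22.
by rewrite !inE; do 4![case/orP=> /eqP ?]; subst; auto.
Qed.

Lemma parent_edgesE f x y :
  edge_rel (parent_edges f) x y
    = (x != q) && (y == f x) || (y != q) && (x == f y).
Proof.
apply/imsetP/orP => [[z /= zq /set2_eq[[-> ->]|[-> ->]]] | ].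
- by left; rewrite eqxx andbT.
- by right; rewrite eqxx andbT.
case=> /andP[zq /eqP ->]; [by exists x | exists y => //; exact: finset.setUC].
Qed.

Lemma edge_rel_sym F : symmetric (edge_rel F).
Proof. by move=> x y; rewrite /edge_rel finset.setUC. Qed.

Lemma parent_edges_connected f :
  (forall x, fconnect f x q) -> connected_graph (edge_rel (parent_edges f)).
Proof.
move=> fc; have to_q x : connect (edge_rel (parent_edges f)) x q.
  move: x; apply: (parent_map_ind fc) => [|x xq]; first exact: connect0.
  by apply: connect_trans; apply: connect1; rewrite parent_edgesE xq eqxx.
move=> x y; apply: connect_trans (to_q x) _.
by rewrite (sym_connect_sym (edge_rel_sym _)).
Qed.

(** On a cycle, a vertex at maximal distance from the root has both neighbours
    equal to its parent: they coincide, so the cycle has at most two vertices. *)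
Lemma parent_edges_acyclic f :
  (forall x, fconnect f x q) -> acyclic_graph (edge_rel (parent_edges f)).
Proof.
move=> fc p /andP[cyc_p uniq_p]; rewrite leqNgt; apply/negP => size_p.
have [x0 x0p] : exists x, x \in p.
  by case: p size_p {cyc_p uniq_p} => // x p; exists x; rewrite mem_head.
have [x xp x_max] := arg_maxnP (fun x => findex f x q) x0p.
(* A neighbour of [x] on the cycle is no deeper than [x]: it is its parent. *)
have parent y : y \in p -> edge_rel (parent_edges f) x y -> y = f x.
  move=> yp; rewrite parent_edgesE => /orP[/andP[_ /eqP] //|/andP[yq /eqP xE]].
  by have := x_max y yp; rewrite /= (depth_parent (fc y)) // -xE ltnn.
have next_x : next p x = f x.
  by apply: parent; rewrite ?mem_next //; exact: next_cycle.
have prev_x : prev p x = f x.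
  by apply: parent; rewrite ?mem_prev // edge_rel_sym; exact: prev_cycle.
have nn : next p (next p x) = x by rewrite next_x -prev_x next_prev.
case: (rot_to xp) => i s rot_p.
have := size_rot i p; rewrite rot_p => szs.
have urot : uniq (x :: s) by rewrite -rot_p rot_uniq.
rewrite -!(next_rot i uniq_p) rot_p in nn.
case: s szs urot nn {rot_p} => [|y [|z s]] szs; move: size_p.
all: rewrite -szs //= => _.
move=> /andP[]; rewrite !inE !negb_or => /and3P[xy xz _] _.
by rewrite eqxx eq_sym (negbTE xy) eqxx => zx; rewrite zx eqxx in xz.
Qed.

Lemma parent_edges_sub r f :
  (forall x, x != q -> r x (f x)) -> parent_edges f \subset edges r.
Proof.
move=> fr; apply/fintype.subsetP => E /imsetP[x xq ->].
by apply/imsetP; exists (x, f x) => //; rewrite inE fr.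
Qed.

(** Going up from the root, suppose that [f] and [g] agree at [f x]. The edge
    joining [x] and [f x] is either the [g]-edge of [x], as wanted, or that of
    [f x]; but then [f] would exchange [x] and [f x] and never reach [q]. *)
Lemma parent_edges_inj f g :
    f q = q -> g q = q -> (forall x, fconnect f x q) ->
    (forall x, fconnect g x q) ->
  parent_edges f = parent_edges g -> f = g.
Proof.
move=> fq gq fc gc eqE; apply/ffunP.
apply: (parent_map_ind fc) => [|x xq IHx]; first by rewrite fq gq.
have: edge_rel (parent_edges g) x (f x) by rewrite -eqE parent_edgesE xq eqxx.
rewrite parent_edgesE xq => /orP[/eqP //|/andP[fxq /eqP xE]].
rewrite -IHx in xE; have := depth_parent (fc _) fxq.
rewrite -xE (depth_parent (fc x)) // => /eqP.
by rewrite -addn2 -{1}[findex _ _ _]addn0 eqn_add2l.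
Qed.

Lemma spanning_tree_parent_edges r f : symmetric r ->
  parent_map r q f -> spanning_tree r (parent_edges f).
Proof.
move=> r_sym /parent_mapP[_ fr fc]; split; first exact: parent_edges_sub.
by split; [exact: parent_edges_connected | exact: parent_edges_acyclic].
Qed.

Lemma edges_rel r F x y : symmetric r -> F \subset edges r ->
  edge_rel F x y -> r x y.
Proof.
move=> r_sym /fintype.subsetP sub /sub/imsetP[[z w]]; rewrite inE /= => rzw.
by case/set2_eq=> [[-> ->]|[-> ->]] //; rewrite r_sym.
Qed.

(** The tree is connected, so it contains the edges of a parent map. These
    already connect all vertices: a further edge would close a cycle. *)
Lemma spanning_tree_has_parent_map r F : symmetric r -> irreflexive r ->
  spanning_tree r F -> exists2 f, parent_map r q f & F = parent_edges f.
Proof.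
move=> r_sym r_irr [F_sub [F_conn F_acyc]].
have [f fP] := exists_parent_map F_conn; have [fq fF fc] := parent_mapP _ _ fP.
have fr x : x != q -> r x (f x) by move=> /fF; exact: edges_rel.
exists f; first by apply/parent_mapP.
apply/eqP; rewrite finset.eqEsubset; apply/andP; split; last first.
  by apply/fintype.subsetP => E /imsetP[x xq ->]; exact: fF.
apply/fintype.subsetP => E EF; apply: contraT => notE.
have /imsetP[[x y]] := fintype.subsetP F_sub E EF; rewrite inE /= => rxy E_xy.
have Fxy : edge_rel F x y by rewrite /edge_rel -E_xy.
have notxy : ~~ edge_rel (parent_edges f) x y by rewrite /edge_rel -E_xy.
have /connectP[p pathp yE] := parent_edges_connected fc x y.
move: pathp yE; case/shortenP=> p' pathp' uniqp' _ yE.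
have subF u v : edge_rel (parent_edges f) u v -> edge_rel F u v.
  by case/imsetP=> w wq uvE; rewrite /edge_rel uvE; exact: fF.
have: size (x :: p') <= 2.
  apply: F_acyc; rewrite /ucycle uniqp' andbT /= rcons_path -yE.
  by rewrite edge_rel_sym Fxy andbT; exact: sub_path pathp'.
case: p' pathp' yE {uniqp'} => [_ yE|z [|? ?] //= /andP[xz _] zE _].
  by move: rxy; rewrite yE /= r_irr.
by rewrite zE xz in notxy.
Qed.

Theorem num_spanning_trees_parent_maps r : symmetric r -> irreflexive r ->
  num_spanning_trees r = #|parent_map r q|.
Proof.
move=> r_sym r_irr; rewrite /num_spanning_trees.
rewrite -(card_in_imset (f := parent_edges) (D := parent_map r q)); last first.
  move=> f g /parent_mapP[? _ ?] /parent_mapP[? _ ?].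
  exact: parent_edges_inj.
apply: eq_card => F; rewrite inE; apply/asboolP/imsetP => [|[f fP ->]].
  by move/(spanning_tree_has_parent_map r_sym r_irr).
exact: spanning_tree_parent_edges.
Qed.

End ParentMaps.

(** * The matrix-tree theorem *)

(** Matrices indexed by vertices, made available to the determinant theory. *)
Definition mx_of (R : Type) (V : finType) (M : V -> V -> R) : 'M[R]_#|V| :=
  \matrix_(i, j) M (enum_val i) (enum_val j).

(** Multilinearity of the determinant in all rows at once. *)
Lemma det_sum_rows (R : comPzRingType) (V W : finType) (M : V -> W -> V -> R) :
  \det (mx_of (fun x y => \sum_z M x z y)) =
  \sum_(f : {ffun V -> W}) \det (mx_of (fun x y => M x (f x) y)).
Proof.
have prod_mx (B : V -> V -> R) (s : 'S_#|V|) :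
    \prod_i mx_of B i (s i) = \prod_x B x (enum_val (s (enum_rank x))).
  rewrite (reindex enum_rank); last by apply: onW_bij; exact: enum_rank_bij.
  by apply: eq_bigr => x _; rewrite mxE enum_rankK.
rewrite /determinant exchange_big; apply: eq_bigr => s _.
rewrite prod_mx bigA_distr_bigA -mulr_sumr.
by under [in RHS]eq_bigr do rewrite prod_mx.
Qed.

Lemma det_row_eq0 (R : comPzRingType) (V : finType) (M : V -> V -> R) x :
  (forall y, M x y = 0) -> \det (mx_of M) = 0.
Proof.
move=> Mx0; rewrite (expand_det_row _ (enum_rank x)) big1 // => j _.
by rewrite mxE enum_rankK Mx0 mul0r.
Qed.

(** The grounded Laplacian of the digraph whose arcs go from each vertex other
    than [q] to its parent. *)
Definition functional_mx
    (V : finType) (q : V) (f : {ffun V -> V}) (x y : V) : int :=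
  (x == y)%:Z - ((x != q) && (f x == y))%:Z.

(** Ordered by distance to the root, the matrix is unitriangular: in the
    expansion over permutations only the identity survives. *)
Lemma det_functional_mx1 (V : finType) (q : V) (f : {ffun V -> V}) :
  f q = q -> (forall x, fconnect f x q) -> \det (mx_of (functional_mx q f)) = 1.
Proof.
move=> fq fc; set A := mx_of _; rewrite /determinant.
rewrite (bigD1 (1%g : {perm _})) //= odd_perm1 mul1r big1 => [|i _]; last first.
  rewrite perm1 mxE /functional_mx eqxx; case: eqVneq => //= xq.
  case: eqP (depth_parent (fc _) xq) => [->|//] /eqP.
  by rewrite -addn1 -{1}[findex _ _ _]addn0 eqn_add2l.
rewrite big1 ?addr0 // => s s1.
have [i si] : exists i, s i != i.
  apply/existsP; apply: contraR s1 => /existsPn sid; apply/eqP/permP => i.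
  by rewrite perm1; apply/eqP; rewrite -[_ == _]negbK.
(* Take an index of minimal depth moved by [s]. The only other nonzero entry of
   its row is at its parent, which [s] would move too and which is less deep. *)
have [j sj j_min] := arg_minnP (P := [pred i | s i != i])
  (fun i => findex f (enum_val i) q) si.
rewrite (bigD1 j) //= [A _ _](_ : _ = 0) ?mul0r ?mulr0 //.
rewrite mxE /functional_mx (inj_eq enum_val_inj) eq_sym (negbTE sj).
case: eqVneq => //= xq; case: eqP => //= fE.
have /j_min : s (s j) != s j by rewrite (inj_eq perm_inj).
by rewrite /= (depth_parent (fc _) xq) fE ltnn.
Qed.

Lemma det_functional_mx0 (V : finType) (q : V) (f : {ffun V -> V}) x :
  f q = q -> ~~ fconnect f x q -> \det (mx_of (functional_mx q f)) = 0.
Proof.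
move=> fq nx; set A := mx_of _.
(* The indicator of the vertices that never reach [q] is in the kernel. *)
pose u : 'cV[int]_#|V| := \col_i (~~ fconnect f (enum_val i) q)%:Z.
have Au : A *m u = 0.
  apply/colP => i; rewrite !mxE.
  rewrite (reindex enum_rank); last by apply: onW_bij; exact: enum_rank_bij.
  set y := enum_val i.
  under eq_bigr => z _ do rewrite !mxE enum_rankK mulrBl -/y.
  rewrite sumrB /= (bigD1 y) //= big1 => [|z /negbTE zy]; last first.
    by rewrite eq_sym zy mul0r.
  rewrite eqxx mul1r addr0.
  rewrite (bigD1 (f y)) //= big1 => [|z /negbTE zy]; last first.
    by rewrite [f y == z]eq_sym zy andbF mul0r.
  rewrite eqxx andbT addr0; case: eqVneq => [->|yq]; first by rewrite connect0.
  rewrite mul1r; suff -> : fconnect f y q = fconnect f (f y) q by rewrite subrr.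
  apply/idP/idP => [fyq|]; last exact: connect_trans (fconnect1 _ _).
  by rewrite -(iter_findex fyq) depth_parent // iterSr fconnect_iter.
have := congr1 (fun B => (\adj A *m B) (enum_rank x) 0) Au.
by rewrite /= mulmxA mul_adj_mx mulmx0 mul_scalar_mx !mxE enum_rankK nx mulr1.
Qed.

(** Firing [x] subtracts row [x]. *)
Definition laplacian (V : finType) (e : rel V) (x y : V) : int :=
  (degree e x)%:Z * (x == y)%:Z - (e x y)%:Z.

(** Row [q] of the Laplacian depends on the others. Replacing it by a unit vector
    makes the rows of a connected graph span a lattice of full rank in Z^V,
    with the same vectors of sum zero. *)
Definition grounded_laplacian (V : finType) (e : rel V) (q x y : V) : int :=
  if x == q then (y == q)%:Z else laplacian e x y.

(** Each row is a sum over the possible parents of its vertex, ready for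
    [det_sum_rows]. *)
Lemma grounded_laplacianE (V : finType) (e : rel V) (q x y : V) :
  grounded_laplacian e q x y =
  \sum_z (if x == q then z == q else e x z)%:Z
          * ((x == y)%:Z - ((x != q) && (z == y))%:Z).
Proof.
rewrite /grounded_laplacian; case: eqVneq => [->|xq] /=.
  rewrite (bigD1 q) //= eqxx big1 => [|z /negbTE->]; last by rewrite mul0r.
  by rewrite mul1r subr0 addr0 eq_sym.
under eq_bigr => z _ do rewrite mulrBr.
rewrite sumrB -mulr_suml; congr (_ * _ - _).
  rewrite /degree -sum1_card big_mkcond (big_morph Posz PoszD (erefl _)).
  by apply: eq_bigr => z _; rewrite inE; case: (e x z).
rewrite (bigD1 y) //= eqxx mulr1 big1 ?addr0 // => z /negbTE->.
by rewrite mulr0.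
Qed.

(** The matrix-tree theorem, with spanning trees replaced by parent maps. *)
Theorem det_grounded_laplacian (V : finType) (e : rel V) (q : V) :
  \det (mx_of (grounded_laplacian e q)) = #|parent_map e q|%:Z.
Proof.
pose w x z := if x == q then z == q else e x z.
pose B x z y : int := (x == y)%:Z - ((x != q) && (z == y))%:Z.
have -> : mx_of (grounded_laplacian e q)
        = mx_of (fun x y => \sum_z (w x z)%:Z * B x z y).
  by apply/matrixP => i j; rewrite !mxE grounded_laplacianE.
rewrite det_sum_rows.
rewrite -[#|parent_map e q|]sum1_card.
rewrite [RHS](big_morph Posz PoszD (erefl _)) [RHS]big_mkcond.
apply: eq_bigr => f _.
have [/forallP fw | ] := boolP [forall x, w x (f x)]; last first.
  rewrite negb_forall => /existsP[x nw]; rewrite (@det_row_eq0 _ _ _ x) => [|y].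
    case: ifP => // /forallP/(_ x)/andP[]; rewrite /w in nw.
    by move: nw; case: ifP => // _ /negbTE->.
  by rewrite (negbTE nw) mul0r.
have fq : f q = q by have := fw q; rewrite /w eqxx => /eqP.
have -> : mx_of (fun x y => (w x (f x))%:Z * B x (f x) y)
        = mx_of (functional_mx q f).
  by apply/matrixP => i j; rewrite !mxE fw mul1r.
case: ifPn => [/forallP fc | ].
  by apply: det_functional_mx1 => // x; have /andP[] := fc x.
rewrite negb_forall => /existsP[x]; have := fw x; rewrite /w /= => ->.
exact: det_functional_mx0.
Qed.

(** * The quotient of Z^V by a full lattice *)

Lemma absz_prod (I : finType) (F : I -> int) :
  `|(\prod_i F i)%R|%N = (\prod_i `|F i|%N)%N.
Proof. by rewrite (big_morph absz abszM (erefl _)). Qed.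

Lemma absz_det_unitmx n (A : 'M[int]_n) : A \in unitmx -> `|\det A|%N = 1%N.
Proof.
rewrite unitmxE => /mulVr /(congr1 absz) /eqP; rewrite abszM muln_eq1.
by case/andP=> _ /eqP.
Qed.

Lemma modz_ord_eq (d x y : int) : d != 0 ->
  (inord `|(x %% d)%Z|%N == inord `|(y %% d)%Z|%N :> 'I_(`|d|.-1.+1))
    = (d %| x - y)%Z.
Proof.
move=> d0; have d_gt0 : (0 < `|d|)%N by rewrite absz_gt0.
have lt_d z : (`|(z %% d)%Z| < `|d|.-1.+1)%N.
  by rewrite prednK // -ltz_nat gez0_abs ?modz_ge0 // abszE ltz_mod.
rewrite -val_eqE /= !inordK // -eqz_mod_dvd -eqz_nat !gez0_abs ?modz_ge0 //.
Qed.

(** In the bases given by the Smith normal form the lattice is a product of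
    subgroups d_j Z. The class of a vector is the list of the residues of its
    coordinates modulo the d_j, whose product is the determinant up to sign. *)
Theorem lattice_quotient n (A : 'M[int]_n) : \det A != 0 ->
  exists (K : finType) (phi : 'rV[int]_n -> K),
    [/\ #|K| = `|\det A|%N, forall g, exists x, phi x = g
      & forall x y, phi x = phi y <-> exists u, x - y = u *m A].
Proof.
case: (int_Smith_normal_form A) => P Pu [Q Qu [d _ AE]] detA.
pose dd (j : 'I_n) : int := d`_j; pose D := \row_j dd j.
have {}AE : A = P *m diag_mx D *m Q.
  by rewrite AE; congr (_ *m _ *m _); apply/matrixP => i j; rewrite !mxE.
have detE : `|\det A|%N = (\prod_j `|dd j|%N)%N.
  rewrite {1}AE !det_mulmx !abszM det_diag !absz_det_unitmx // mul1n muln1.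
  by rewrite absz_prod; under eq_bigr do rewrite mxE.
have D0 j : dd j != 0.
  have: (0 < `|\det A|%N)%N by rewrite absz_gt0.
  by rewrite detE (bigD1 j) //= muln_gt0 absz_gt0; case/andP.
pose K : finType := {dffun forall j : 'I_n, 'I_(`|dd j|.-1.+1)}.
pose phi (x : 'rV[int]_n) : K :=
  [ffun j => inord `|((x *m invmx Q) 0%R j %% dd j)%Z|%N].
exists K, phi; split.
- rewrite card_dep_ffun foldrE big_map big_enum detE; apply: eq_bigr => j _.
  by rewrite card_ord prednK // absz_gt0.
- move=> g; exists ((\row_j (g j : nat)%:Z) *m Q); apply/ffunP => j.
  rewrite ffunE mulmxK // mxE -modz_abs modz_small.
    by apply/val_inj; rewrite /= inordK.
  have d_gt0 : (0 < `|dd j|%N)%N by rewrite absz_gt0.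
  rewrite lez_nat ltz_nat /=; apply: leq_trans (ltn_ord (g j)) _.
  by rewrite prednK.
move=> x y.
have phiE : phi x = phi y <-> forall j, (dd j %| ((x - y) *m invmx Q) 0%R j)%Z.
  split=> [E j | E].
    have := congr1 (fun g : K => g j) E; rewrite !ffunE => /eqP.
    by rewrite modz_ord_eq // mulmxBl !mxE.
  apply/ffunP => j; rewrite !ffunE; apply/eqP; rewrite modz_ord_eq //.
  by have := E j; rewrite mulmxBl !mxE.
rewrite phiE; split=> [dv | [u ->] j].
  pose z := \row_j (((x - y) *m invmx Q) 0%R j %/ dd j)%Z.
  exists (z *m invmx P); rewrite AE !mulmxA mulmxKV //.
  suff -> : z *m diag_mx D = (x - y) *m invmx Q by rewrite mulmxKV.
  apply/rowP => j; rewrite mul_mx_diag !mxE divzK //.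
  by have := dv j; rewrite !mxE.
by rewrite AE !mulmxA mulmxK // mul_mx_diag mxE [D 0 j]mxE dvdz_mull.
Qed.

Definition lattice (V : finType) (M : V -> V -> int) (x : V -> int) : Prop :=
  exists u : V -> int, forall v, x v = \sum_w u w * M w v.

Definition row_of (V : finType) (x : V -> int) : 'rV[int]_#|V| :=
  \row_j x (enum_val j).

Lemma lattice_row (V : finType) (M : V -> V -> int) (x : V -> int) :
  lattice M x <-> exists u, row_of x = u *m mx_of M.
Proof.
have sumE u j : (\sum_w u (enum_rank w) * M w (enum_val j)) =
    ((\row_i u i) *m mx_of M) 0 j.
  rewrite mxE [RHS](reindex enum_rank); last first.
    by apply: onW_bij; exact: enum_rank_bij.
  by apply: eq_bigr => w _; rewrite !mxE enum_rankK.
split=> [[u uE] | [u uE]].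
  exists (\row_i u (enum_val i)); apply/rowP => j; rewrite -sumE mxE uE.
  by apply: eq_bigr => w _; rewrite enum_rankK.
exists (fun w => u 0 (enum_rank w)) => v.
have -> : x v = (row_of x) 0 (enum_rank v) by rewrite mxE enum_rankK.
rewrite uE -[in RHS](enum_rankK v) (sumE (fun i => u 0 i)).
by congr ((_ *m _) _ _); apply/rowP => j; rewrite mxE.
Qed.

Corollary lattice_index (V : finType) (M : V -> V -> int) :
  \det (mx_of M) != 0 ->
  exists (K : finType) (phi : (V -> int) -> K),
    [/\ #|K| = `|\det (mx_of M)|%N, forall g, exists x, phi x = g
      & forall x y, phi x = phi y <-> lattice M (fun v => x v - y v)].
Proof.
case/lattice_quotient => K [phi [cardK surj phiP]].
exists K, (fun x => phi (row_of x)); split=> // [g|x y].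
  have [x <-] := surj g; exists (fun v => x 0 (enum_rank v)); congr phi.
  by apply/rowP => j; rewrite mxE enum_valK.
rewrite phiP lattice_row.
suff -> : row_of x - row_of y
       = row_of (fun v => x v - y v) by [].
by apply/rowP => j; rewrite !mxE.
Qed.

(** By the adjugate formula, the determinant annihilates the quotient. *)
Lemma lattice_det (V : finType) (M : V -> V -> int) (x : V -> int) :
  lattice M (fun v => \det (mx_of M) * x v).
Proof.
apply/lattice_row; exists (row_of x *m \adj (mx_of M)).
by rewrite -mulmxA mul_adj_mx mul_mx_scalar; apply/rowP => j; rewrite !mxE.
Qed.

Lemma latticeD (V : finType) (M : V -> V -> int) (x y : V -> int) :
  lattice M x -> lattice M y -> lattice M (fun v => x v + y v).
Proof.
move=> [u uE] [w wE]; exists (fun i => u i + w i) => v.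
by rewrite uE wE -big_split; apply: eq_bigr => i _; rewrite mulrDl.
Qed.

Lemma latticeZ (V : finType) (M : V -> V -> int) (a : int) (x : V -> int) :
  lattice M x -> lattice M (fun v => a * x v).
Proof.
move=> [u uE]; exists (fun i => a * u i) => v.
by rewrite uE mulr_sumr; apply: eq_bigr => i _; rewrite mulrA.
Qed.

Lemma lattice_gen (V : finType) (M : V -> V -> int) (w : V) : lattice M (M w).
Proof.
exists (fun i => (i == w)%:Z) => v; rewrite (bigD1 w) //= eqxx mul1r.
by rewrite big1 ?addr0 // => i /negbTE->; rewrite mul0r.
Qed.

(** * Firing and the Laplacian lattice *)

Section Firing.
Variables (V : finType) (e : rel V) (q : V).
Hypotheses (e_sym : symmetric e) (e_irr : irreflexive e).
Implicit Types C D : config V.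

Lemma degreeE x : degree e x = (\sum_y e x y)%N.
Proof.
rewrite /degree -sum1_card big_mkcond; apply: eq_bigr => y _.
by rewrite inE; case: (e x y).
Qed.

Lemma sum_mul_lap (u : V -> int) y :
  \sum_x u x * laplacian e x y
    = u y * (degree e y)%:Z - \sum_x u x * (e x y)%:Z.
Proof.
under eq_bigr do rewrite mulrBr; rewrite sumrB; congr (_ - _).
rewrite (bigD1 y) //= eqxx mulr1 big1 ?addr0 // => x /negbTE->.
by rewrite !mulr0.
Qed.

Lemma lap_sum_col y : \sum_x laplacian e x y = 0.
Proof.
have := sum_mul_lap (fun=> 1) y; under eq_bigr do rewrite mul1r.
move=> ->; rewrite mul1r degreeE (big_morph Posz PoszD (erefl _)) -sumrB.
by apply: big1 => x _; rewrite mul1r e_sym subrr.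
Qed.

Lemma lap_sym x y : laplacian e x y = laplacian e y x.
Proof.
rewrite /laplacian e_sym [y == x]eq_sym.
by case: eqP => [->|_]; rewrite ?mulr0.
Qed.

Lemma lap_sum_row x : \sum_y laplacian e x y = 0.
Proof. by under eq_bigr do rewrite lap_sym; exact: lap_sum_col. Qed.

(** The missing row [q] is minus the sum of the other rows, since columns of the
    Laplacian sum to zero. *)
Lemma lattice_lap x : lattice (grounded_laplacian e q) (laplacian e x).
Proof.
have [->|xq] := eqVneq x q; last first.
  have [u uE] := lattice_gen (grounded_laplacian e q) x.
  exists u => v; rewrite -uE.
  by rewrite /grounded_laplacian (negbTE xq).
exists (fun x => - (x != q)%:Z) => v; have /eqP := lap_sum_col v.
rewrite (bigD1 q) //= addr_eq0 => /eqP->; rewrite [RHS](bigD1 q) //= eqxx.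
rewrite oppr0 mul0r add0r -sumrN; apply: eq_bigr => w /[dup] wq /negbTE wq'.
by rewrite /grounded_laplacian wq' mulN1r.
Qed.

(** Row [q] of the grounded Laplacian has sum one and the other rows sum zero, so
    the coefficient of row [q] is the sum of the vector. *)
Lemma lattice_sum0 (x : V -> int) : lattice (grounded_laplacian e q) x ->
  \sum_v x v = 0 -> exists u, forall v, x v = \sum_w u w * laplacian e w v.
Proof.
move=> [u uE]; under eq_bigr do rewrite uE.
rewrite exchange_big (bigD1 q) //=.
rewrite [X in _ + X]big1 => [|w /negbTE wq]; last first.
  by rewrite -mulr_sumr /grounded_laplacian wq lap_sum_row mulr0.
rewrite -mulr_sumr (bigD1 q) //= big1 => [|w wq]; last first.
  by rewrite /grounded_laplacian eqxx (negbTE wq).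
rewrite {1}/grounded_laplacian !eqxx !addr0 mulr1 => uq; exists u => v.
rewrite uE; apply: eq_bigr => w _; rewrite /grounded_laplacian.
by case: eqVneq => // ->; rewrite uq !mul0r.
Qed.

(** Here [w] counts how often each vertex is to be fired. Where [w] is maximal, a
    vertex loses at least as much as it gains on the way to [D], so it starts
    with at least its degree and can be fired next. *)
Lemma reachable_script (w : V -> nat) C D :
    (forall i, degree e i <= D i)%N ->
    (forall j, D j + w j * degree e j = C j + \sum_i w i * e i j)%N ->
  reachable e C D.
Proof.
move=> deg_D; have [n] := ubnP (\sum_i w i)%N.
elim: n w C => // n IHn w C lt_n CD.
have [w0|[i0 w_i0]] : (forall i, w i = 0%N) \/ exists i, (0 < w i)%N.
  have [/existsP|/existsPn nw] := boolP [exists i, (0 < w i)%N]; first by right.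
  by left=> i; apply/eqP; rewrite -leqn0 leqNgt.
  exists [::] => //; apply/ffunP => j; have := CD j.
  by rewrite w0 mul0n addn0 big1 ?addn0 // => i _; rewrite w0 mul0n.
have [i _ w_max] := arg_maxnP w (isT : xpredT i0).
have w_i : (0 < w i)%N by apply: leq_trans w_i0 (w_max i0 isT).
have deg_C : (degree e i <= C i)%N.
  apply: leq_trans (deg_D i) _.
  rewrite -(leq_add2r (w i * degree e i)%N) CD leq_add2l.
  rewrite degreeE big_distrr /=; apply: leq_sum => j _; rewrite e_sym.
  by rewrite leq_mul2r; apply/orP; right; exact: w_max.
pose w' j := (w j - (j == i))%N.
have wE j : w j = (w' j + (j == i))%N by rewrite subnK //; case: eqP => // ->.
have [|j|s s_path s_last] := IHn w' (fire e i C).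
- move: lt_n; under eq_bigr do rewrite wE.
  rewrite big_split /= [X in (_ + X)%N](bigD1 i) //= eqxx addnCA add1n ltnS.
  exact: leq_ltn_trans (leq_addr _ _).
- have /eqP := CD j; under eq_bigr do rewrite wE mulnDl.
  rewrite big_split /= [X in (_ + (_ + X))%N](bigD1 i) //= eqxx mul1n.
  rewrite [X in (e i j + X)%N]big1 => [|k /negbTE->]; last by rewrite mul0n.
  rewrite {1}wE mulnDl ffunE addn0.
  case: (eqVneq j i) => [->|_] /eqP E; last by lia.
  by move: E; rewrite e_irr mul1n; lia.
exists (fire e i C :: s) => //=; rewrite s_path andbT.
by apply/existsP; exists i; rewrite deg_C /=.
Qed.

Lemma lattice_reachable C D :
    (forall i, degree e i <= D i)%N -> chips C = chips D ->
    lattice (grounded_laplacian e q) (fun v => (C v)%:Z - (D v)%:Z) ->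
  reachable e C D.
Proof.
move=> deg_D eq_chips /lattice_sum0[|u uE].
  rewrite sumrB; move/(congr1 Posz): eq_chips; rewrite /chips.
  by rewrite !(big_morph Posz PoszD (erefl _)) => ->; rewrite subrr.
(* Firing every vertex once changes nothing, so the script may be shifted. *)
pose N : int := \sum_w `|u w|.
have uN v : 0 <= u v + N.
  rewrite /N (bigD1 v) //= addrA addr_ge0 ?sumr_ge0 //.
  by rewrite -lerBlDl sub0r -normrN ler_norm.
apply: (reachable_script (w := fun v => absz (u v + N)%R)) => // j.
have := uE j; rewrite sum_mul_lap => E.
apply/eqP; rewrite -eqz_nat !PoszD (big_morph Posz PoszD (erefl _)).
rewrite PoszM gez0_abs //.
under eq_bigr do rewrite PoszM gez0_abs // mulrDl.
rewrite big_split /= -mulr_sumr -(big_morph Posz PoszD (erefl _)).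
have -> : (\sum_i e i j)%N = degree e j.
  by rewrite degreeE; apply: eq_bigr => i _; rewrite e_sym.
move/eqP: E; rewrite subr_eq => /eqP ->; apply/eqP; ring.
Qed.

Lemma reachable_lattice C D : reachable e C D ->
  lattice (grounded_laplacian e q) (fun v => (C v)%:Z - (D v)%:Z).
Proof.
move=> [s + <-]; elim: s C => [C _|E s IHs C] /=.
  by exists (fun=> 0) => v; rewrite subrr big1 // => w _; rewrite mul0r.
case/andP=> /existsP[i /andP[deg_C /eqP->{E}]] /IHs fireD.
have [u uE] := latticeD (lattice_lap i) fireD; exists u => v; rewrite -uE ffunE.
rewrite addrA; congr (_ - _); rewrite /laplacian eq_sym; case: eqVneq => [->|_].
  by rewrite e_irr mulr1 subr0 -PoszD subnKC.
by rewrite mulr0 PoszD addrA add0r addrAC addNr add0r.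
Qed.

End Firing.

(** * Counting the configurations of a class *)

Definition level (V : finType) (c : nat) : {fset config V} :=
  fset_set [set D : config V | chips D = c].

(** Stars and bars. *)
Lemma card_level (V : finType) (c m : nat) : #|V| = m.+1 ->
  finite_set [set D : config V | chips D = c] /\
  #|` level V c|%fset = 'C(m + c, m).
Proof.
move=> cardV.
pose rk (v : V) : 'I_m.+1 := cast_ord cardV (enum_rank v).
have rk_bij : bijective rk.
  exists (fun i => enum_val (cast_ord (esym cardV) i)) => x.
    by rewrite /rk cast_ordK enum_rankK.
  by rewrite /rk enum_valK cast_ordKV.
pose h (t : m.+1.-tuple 'I_c.+1) : config V := [ffun v => tnth t (rk v) : nat].
pose P := [set t : m.+1.-tuple 'I_c.+1 | \sum_(i <- t) i == c]%N%SET.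
have h_inj : injective h.
  move=> t u /ffunP tu; apply: eq_from_tnth => i; have [rk' _ rk'K] := rk_bij.
  by apply/val_inj; have := tu (rk' i); rewrite !ffunE rk'K.
have chips_h t : chips (h t) = (\sum_(i <- t) i)%N.
  rewrite /chips big_tuple (reindex rk) /=; last by apply: onW_bij.
  by apply: eq_bigr => v _; rewrite ffunE.
have levelE :
    [set D : config V | chips D = c] = [set` [fset h t | t in P]%fset].
  apply/seteqP; split=> D /=.
    move=> Dc; apply/imfsetP => /=.
    have [rk' rkK rk'K] := rk_bij.
    pose t := [tuple inord (D (rk' i)) : 'I_c.+1 | i < m.+1].
    have DE : D = h t.
      apply/ffunP => v; rewrite ffunE tnth_mktuple rkK inordK //.
      by rewrite ltnS -Dc /chips (bigD1 v) //= leq_addr.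
    by exists t => //; rewrite inE -chips_h -DE Dc.
  by case/imfsetP => t /=; rewrite inE -chips_h => /eqP Dc ->.
split; first by rewrite levelE; exact: finite_fset.
rewrite /level levelE set_fsetK card_imfset //= -card_ord_partitions.
by rewrite cardE.
Qed.

Section Counting.
Variables (V : finType) (e : rel V) (q : V).
Hypotheses (e_sym : symmetric e) (e_irr : irreflexive e).
Variables (K : finType) (phi : (V -> int) -> K).
Hypothesis det_neq0 : \det (mx_of (grounded_laplacian e q)) != 0.
Hypothesis phi_surj : forall g, exists x, phi x = g.
Hypothesis phiP : forall x y,
  phi x = phi y <-> lattice (grounded_laplacian e q) (fun v => x v - y v).
Implicit Types C D E : config V.

Let cls D : K := phi (fun v => (D v)%:Z).
Let addc D E : config V := [ffun v => (D v + E v)%N].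

(** Lift the difference of the classes to an integer vector. Adding multiples of
    the determinant makes it as large as wanted without changing its class, and
    multiples of the unit vector at [q] then adjust the number of chips. *)
Lemma exists_translation (a : config V) (g h : K) : exists b0, forall b,
  (b0 <= b)%N -> exists E, [/\ chips E = b, forall v, (a v <= E v)%N
    & forall D, cls D = g -> cls (addc D E) = h].
Proof.
have [x xg] := phi_surj g; have [y yh] := phi_surj h.
pose d := \det (mx_of (grounded_laplacian e q)).
have d_neq0 : d != 0 := det_neq0.
pose N : int := \sum_v ((a v)%:Z + `|y v - x v|).
(* The square of [d] is positive, whatever the sign of [d]. *)
pose t v : int := (y v - x v) + d * (d * N).
have a_t v : (a v)%:Z <= t v.
  have N_ge : (a v)%:Z + `|y v - x v| <= N.
    by rewrite /N (bigD1 v) //= lerDl sumr_ge0 // => w _; rewrite addr_ge0.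
  have N_ge0 : 0 <= N by apply: le_trans N_ge; rewrite addr_ge0.
  have : N <= d * (d * N).
    rewrite mulrA ler_peMl // -expr2 -gtz0_ge1 lt_neqAle sqr_ge0 andbT eq_sym.
    by rewrite expf_neq0.
  have := ler_norm (- (y v - x v)); rewrite normrN /t; lia.
exists `|(\sum_v t v)%R|%N => b le_b.
pose s : int := b%:Z - \sum_v t v.
have s_ge0 : 0 <= s.
  rewrite subr_ge0; apply: le_trans (ler_norm _) _.
  by rewrite -abszE lez_nat.
have E_ge0 v : 0 <= t v + s * (v == q)%:Z.
  by rewrite addr_ge0 ?mulr_ge0 //; apply: le_trans (a_t v).
pose E : config V := [ffun v => absz (t v + s * (v == q)%:Z)%R].
have EE v : (E v)%:Z = t v + s * (v == q)%:Z by rewrite ffunE gez0_abs.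
exists E; split.
- apply/eqP; rewrite -eqz_nat /chips (big_morph Posz PoszD (erefl _)).
  under eq_bigr do rewrite EE.
  rewrite big_split /= -mulr_sumr [X in _ + s * X](bigD1 q) //= eqxx.
  rewrite [X in s * (_ + X)]big1.
    by rewrite addr0 mulr1 /s addrC subrK.
  by move=> v /negbTE->.
- move=> v; rewrite -lez_nat EE; apply: le_trans (a_t v) _.
  by rewrite lerDl mulr_ge0.
move=> D; rewrite -xg -yh => /phiP Dx; apply/phiP.
have row_q : lattice (grounded_laplacian e q) (fun v => s * (v == q)%:Z).
  have [u uE] := latticeZ s (lattice_gen (grounded_laplacian e q) q).
  by exists u => v; rewrite -uE /grounded_laplacian eqxx.
have dN := lattice_det (grounded_laplacian e q) (fun=> d * N).
have [u uE] := latticeD (latticeD Dx dN) row_q.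
exists u => v; rewrite -uE ffunE PoszD EE /t -/d; ring.
Qed.

Lemma exists_uniform_translation (a : config V) : exists b, forall g h,
  exists E, [/\ chips E = b, forall v, (a v <= E v)%N
    & forall D, cls D = g -> cls (addc D E) = h].
Proof.
have /fin_all_exists[b0 b0P] : forall gh : K * K, exists b0, forall b,
  (b0 <= b)%N -> exists E, [/\ chips E = b, forall v, (a v <= E v)%N
    & forall D, cls D = gh.1 -> cls (addc D E) = gh.2].
  by move=> [g h]; exact: exists_translation.
exists (\sum_gh b0 gh)%N => g h; apply: (b0P (g, h)).
by rewrite (bigD1 (g, h)) //= leq_addr.
Qed.

Let slice c g : {fset config V} := [fset D in level V c | cls D == g]%fset.

Lemma card_slices c : (\sum_g #|` slice c g|%fset)%N = #|` level V c|%fset.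
Proof.
rewrite card_fset_sum1 (partition_big cls xpredT) //=; apply: eq_bigr => g _.
by rewrite card_fset_sum1 big_fset.
Qed.

Lemma chips_addc D E : chips (addc D E) = (chips D + chips E)%N.
Proof. by rewrite /chips -big_split; apply: eq_bigr => v _; rewrite ffunE. Qed.

Lemma addcI E : injective (addc^~ E).
Proof.
move=> C D /ffunP CD; apply/ffunP => v; have := CD v.
by rewrite !ffunE => /addIn.
Qed.

Lemma in_level c D : (D \in level V c) = (chips D == c).
Proof.
have cardV : #|V| = #|V|.-1.+1 by rewrite prednK //; apply/card_gt0P; exists q.
have [fin _] := card_level c cardV.
by rewrite /level in_fset_set //; apply/idP/eqP; rewrite in_setE.
Qed.

Lemma in_slice c g D : (D \in slice c g) = (chips D == c) && (cls D == g).
Proof. by rewrite !inE /= in_level. Qed.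

Lemma num_reachable_le_slice X :
  (num_reachable e X <= #|` slice (chips X) (cls X)|%fset)%N.
Proof.
apply: fsubset_leq_card; apply/fsubsetP => D.
rewrite in_fset_set; last exact: finite_reachable.
rewrite in_setE /= => XD; rewrite in_slice (chips_reachable e_irr XD) eqxx /=.
apply/eqP/esym/phiP.
exact: reachable_lattice XD.
Qed.

Lemma slice_le_slice : exists b, forall c g h,
  (#|` slice c g|%fset <= #|` slice (c + b) h|%fset)%N.
Proof.
have [b bP] := exists_uniform_translation [ffun=> 0%N]; exists b => c g h.
have [E [cE _ gh]] := bP g h.
have <- : #|` [fset addc C E | C in slice c g]|%fset = #|` slice c g|%fset.
  by rewrite card_imfset //; exact: addcI.
apply: fsubset_leq_card.
apply/fsubsetP => D /imfsetP[C /=].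
rewrite in_slice => /andP[/eqP Cc /eqP Cg] ->.
by rewrite in_slice chips_addc Cc cE gh // !eqxx.
Qed.

(** The translation is taken at least the degree on each vertex, so that every
    translated configuration is reachable. *)
Lemma slice_le_num_reachable : exists b, forall X c g, chips X = (c + b)%N ->
  (#|` slice c g|%fset <= num_reachable e X)%N.
Proof.
have [b bP] := exists_uniform_translation [ffun v => degree e v].
exists b => X c g Xc.
have [E [cE degE gh]] := bP g (cls X).
have <- : #|` [fset addc C E | C in slice c g]|%fset = #|` slice c g|%fset.
  by rewrite card_imfset //; exact: addcI.
apply: fsubset_leq_card.
apply/fsubsetP => D /imfsetP[C /=].
rewrite in_slice => /andP[/eqP Cc /eqP Cg] ->.
rewrite in_fset_set; last exact: finite_reachable.
rewrite in_setE; apply: (lattice_reachable (q := q)) => //.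
- move=> v; rewrite ffunE; have := degE v; rewrite ffunE => /leq_trans-> //.
  by rewrite leq_addl.
- by rewrite chips_addc Cc cE.
by apply/phiP/esym; rewrite -/(cls X) -(gh C Cg).
Qed.

(** Compare the class of [X] with each class in turn and add up: together the
    classes form all configurations with a given number of chips. *)
Theorem num_reachable_bounds m : #|V| = m.+1 -> exists b, forall X,
  (#|K| * num_reachable e X <= 'C(m + (chips X + b), m))%N /\
  ((b <= chips X)%N ->
    ('C(m + (chips X - b), m) <= #|K| * num_reachable e X)%N).
Proof.
move=> cardV; have [b1 b1P] := slice_le_slice.
have [b2 b2P] := slice_le_num_reachable.
have T c : 'C(m + c, m) = (\sum_g #|` slice c g|%fset)%N.
  by rewrite card_slices; case: (card_level c cardV).
have mono c c' : (c <= c')%N -> ('C(m + c, m) <= 'C(m + c', m))%N.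
  by move=> cc'; rewrite leq_bin2l // leq_add2l.
exists (b1 + b2)%N => X; split=> [|le_b].
  apply: leq_trans (mono (chips X + b1)%N _ _); last by lia.
  rewrite T -sum_nat_const; apply: leq_sum => g _.
  exact: leq_trans (num_reachable_le_slice X) (b1P _ _ _).
apply: leq_trans (mono _ (chips X - b2)%N _) _; first by lia.
rewrite T -sum_nat_const; apply: leq_sum => g _; apply: b2P; lia.
Qed.

End Counting.

(** * The asymptotic estimate *)

Lemma leq_exp_base k a b : (a <= b)%N -> (a ^ k <= b ^ k)%N.
Proof. by case: k => // k; rewrite leq_exp2r. Qed.

Lemma ffact_bounds m c : (c ^ m <= (m + c) ^_ m <= (m + c) ^ m)%N.
Proof.
elim: m => [//|m /andP[IHl IHr]]; rewrite addSn ffactSS !expnS.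
rewrite leq_mul //=; last by rewrite -addSn leq_addl.
by rewrite leq_mul2l (leq_trans IHr) ?orbT // leq_exp_base.
Qed.

Lemma num_reachable_asymptotics (V : finType) (e : rel V) :
    symmetric e -> irreflexive e -> connected_graph e -> (0 < #|V|)%N ->
  (0 < num_spanning_trees e)%N /\ exists k, forall X : config V,
    (k <= chips X)%N ->
    ((chips X - k) ^ (#|V| - 1)
       <= (#|V| - 1)`! * num_spanning_trees e * num_reachable e X
       <= (chips X + k) ^ (#|V| - 1))%N.
Proof.
move=> e_sym e_irr e_conn /card_gt0P[q _].
have kE := num_spanning_trees_parent_maps q e_sym e_irr.
have k_gt0 : (0 < num_spanning_trees e)%N.
  rewrite kE; have [f fP] := exists_parent_map q e_conn.
  by apply/card_gt0P; exists f.
split=> //; have detE := det_grounded_laplacian e q; rewrite -kE in detE.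
have det0 : \det (mx_of (grounded_laplacian e q)) != 0.
  by rewrite detE eqz_nat -lt0n.
have [K [phi [cardK surj phiP]]] := lattice_index det0.
have cardV : #|V| = (#|V| - 1).+1.
  by rewrite subn1 prednK //; apply/card_gt0P; exists q.
have [b bP] := num_reachable_bounds e_sym e_irr det0 surj phiP cardV.
move: cardK; rewrite detE /= => cardK; rewrite cardK in bP.
set m := (#|V| - 1)%N in bP *.
exists (m + b)%N => X le_X; have [ub lb] := bP X.
rewrite -mulnA; apply/andP; split.
  have {lb} := lb (leq_trans (leq_addl _ _) le_X).
  rewrite -(leq_pmul2l (fact_gt0 m)); apply: leq_trans.
  rewrite mulnC bin_ffact; have /andP[+ _] := ffact_bounds m (chips X - b).
  by apply: leq_trans; apply: leq_exp_base; rewrite leq_sub2l // leq_addl.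
move: ub; rewrite -(leq_pmul2l (fact_gt0 m)) [X in (_ <= X)%N -> _]mulnC.
rewrite bin_ffact.
move=> /leq_trans; apply; have /andP[_] := ffact_bounds m (chips X + b).
by rewrite addnCA.
Qed.

Lemma cvg_expr_one_plus (R : realType) (a : R) (m : nat) :
  (fun c : nat => (1 + a * c%:R^-1) ^+ m) @ \oo --> (1 : R).
Proof.
have inv0 : (fun c : nat => (c%:R : R)^-1) @ \oo --> (0 : R).
  by rewrite -cvg_shiftS; exact: cvg_harmonic.
have cvg1 : (fun c : nat => 1 + a * (c%:R : R)^-1) @ \oo --> (1 : R).
  rewrite -[X in _ --> X]addr0 -[X in _ --> _ + X](mulr0 a).
  by apply: cvgD; [exact: cvg_cst | apply: cvgM => //; exact: cvg_cst].
rewrite -[X in _ --> X](expr1n _ m).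
elim: m => [|m IHm]; first by under eq_fun do rewrite expr0; exact: cvg_cst.
under eq_fun do rewrite exprS.
by rewrite exprS; apply: cvgM.
Qed.

Theorem theorem6p1 (R : realType) (V : finType) (e : rel V)
    (e_sym : symmetric e) (e_irr : irreflexive e) (e_conn : connected_graph e)
    (X : nat -> config V) (X_chips : forall c : nat, (1 <= c)%N -> chips (X c) = c) :
  (fun c : nat => (num_reachable e (X c))%:R /
     (c%:R ^+ (#|V| - 1) / ((#|V| - 1)`! * num_spanning_trees e)%N%:R) : R)
    @ \oo --> (1 : R).
Proof.
have V_gt0 : (0 < #|V|)%N.
  rewrite lt0n; apply/eqP => /card0_eq V0; have := X_chips 1%N isT.
  by rewrite /chips big1 // => v; have := V0 v; rewrite inE.
have [t_gt0 [k kP]] := num_reachable_asymptotics e_sym e_irr e_conn V_gt0.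
move: (#|V| - 1)%N kP => m kP.
apply: (@squeeze_cvgr _ _ _ _ (fun c : nat => (1 + (- k%:R) * c%:R^-1) ^+ m)
  (fun c : nat => (1 + k%:R * c%:R^-1) ^+ m)); [|exact: cvg_expr_one_plus..].
near=> c.
have c_gt0 : (0 < c)%N by near: c; exact: nbhs_infty_gt.
have k_le : (k <= c)%N by near: c; exact: nbhs_infty_ge.
have cR : (c%:R : R) != 0 by rewrite pnatr_eq0 -lt0n.
have := kP (X c); rewrite X_chips // => /(_ k_le)/andP[lb ub].
set n := (m`! * _)%N in lb ub *.
have -> : 1 + - k%:R * c%:R^-1 = (c - k)%:R / c%:R :> R.
  by rewrite natrB // mulrBl divff // mulNr.
have -> : 1 + k%:R * c%:R^-1 = (c + k)%:R / c%:R :> R.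
  by rewrite natrD mulrDl divff.
have -> : (num_reachable e (X c))%:R / (c%:R ^+ m / n%:R)
    = (n * num_reachable e (X c))%:R / c%:R ^+ m :> R.
  by rewrite invf_div natrM mulrCA mulrA.
rewrite !expr_div_n !ler_pM2r ?invr_gt0 ?exprn_gt0 ?ltr0n //.
by rewrite -!natrX !ler_nat lb ub.
Unshelve. all: by end_near.
Qed.
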